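(* Let $(X,\cdot,\mathbb{C})$ be a $\top$-convergence group with identity element $e$. Then for every $\mathbb{F}\in\mathbb{F}_L^\top(X)$ and every $x\in X$, $$\mathbb{F}\stackrel{\mathbb{C}}{\dashrightarrow}x\iff [x^{-1}]_\top\odot\mathbb{F}\stackrel{\mathbb{C}}{\dashrightarrow}e\iff \mathbb{F}\odot[x^{-1}]_\top\stackrel{\mathbb{C}}{\dashrightarrow}e.$$
   Context: Throughout, $L=(L,\ast)$ is a complete residuated lattice: $(L,\le)$ is a complete lattice with top $\top$ and bottom $\bot$, and $\ast$ is a commutative associative binary operation on $L$ with $a\ast\bigvee_{j}b_j=\bigvee_j(a\ast b_j)$ and $a\ast\top=a$. Put $a\to b=\bigvee\{c\in L: a\ast c\le b\}$. $L^X$ is the set of all maps $X\to L$, with pointwise order and operations. For $\lambda,\mu\in L^X$, $S_X(\lambda,\mu)=\bigwedge_{x\in X}(\lambda(x)\to\mu(x))$. A $\top$-filter on $X$ is a nonempty $\mathbb{F}\subseteq L^X$ such that: $\bigvee_{x\in X}\lambda(x)=\top$ for all $\lambda\in\mathbb{F}$; $\lambda\wedge\mu\in\mathbb{F}$ for all $\lambda,\mu\in\mathbb{F}$; and for $\lambda\in L^X$, $\bigvee_{\mu\in\mathbb{F}}S_X(\mu,\lambda)=\top$ implies $\lambda\in\mathbb{F}$. $\mathbb{F}_L^\top(X)$ is the set of $\top$-filters on $X$. A $\top$-filter base on $X$ is a nonempty $\mathbb{B}\subseteq L^X$ such that $\bigvee_{x}\lambda(x)=\top$ for all $\lambda\in\mathbb{B}$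 and $\bigvee_{\nu\in\mathbb{B}}S_X(\nu,\lambda\wedge\mu)=\top$ for all $\lambda,\mu\in\mathbb{B}$; it generates the $\top$-filter $\{\lambda\in L^X:\bigvee_{\mu\in\mathbb{B}}S_X(\mu,\lambda)=\top\}$. For $x\in X$, $[x]_\top=\{\mu\in L^X:\mu(x)=\top\}$ (a $\top$-filter). For a map $f:X\to Y$ and $\mathbb{F}\in\mathbb{F}_L^\top(X)$, $f^\Rightarrow(\mathbb{F})=\{\mu\in L^Y:\mu\circ f\in\mathbb{F}\}\in\mathbb{F}_L^\top(Y)$. A $\top$-convergence space is a pair $(X,\mathbb{C})$ with $\mathbb{C}:\mathbb{F}_L^\top(X)\to 2^X$, writing $\mathbb{F}\stackrel{\mathbb{C}}{\dashrightarrow}x$ for $x\in\mathbb{C}(\mathbb{F})$, such that (TC1) $[x]_\top\stackrel{\mathbb{C}}{\dashrightarrow}x$ for all $x\in X$; (TC2) $\mathbb{F}\subseteq\mathbb{G}$ and $\mathbb{F}\stackrel{\mathbb{C}}{\dashrightarrow}x$ imply $\mathbb{G}\stackrel{\mathbb{C}}{\dashrightarrow}x$. A map $f:(X,\mathbb{C}_X)\to(Y,\mathbb{C}_Y)$ is continuous if $\mathbb{F}\stackrel{\mathbb{C}_X}{\dashrightarrow}x$ implies $f^\Rightarrow(\mathbb{F})\stackrel{\mathbb{C}_Y}{\dashrightarrow}f(x)$. The product structure $\mathbb{C}\times\mathbb{C}$ on $X\times X$ is given by $\mathbb{F}\stackrel{\mathbb{C}\times\mathbb{C}}{\dashrightarrow}(x_1,x_2)$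 iff $p_i^\Rightarrow(\mathbb{F})\stackrel{\mathbb{C}}{\dashrightarrow}x_i$ for $i=1,2$, where $p_1,p_2$ are the projections. For a group $(X,\cdot)$ and a $\top$-convergence space $(X,\mathbb{C})$, the triple $(X,\cdot,\mathbb{C})$ is a $\top$-convergence group if $m:(X\times X,\mathbb{C}\times\mathbb{C})\to(X,\mathbb{C})$, $(x,y)\mapsto xy$, and $r:(X,\mathbb{C})\to(X,\mathbb{C})$, $x\mapsto x^{-1}$, are continuous. For $\lambda,\mu\in L^X$: $(\lambda\odot\mu)(z)=\bigvee_{xy=z}(\lambda(x)\wedge\mu(y))$. For $\top$-filters $\mathbb{F},\mathbb{G}$ on $X$, $\mathbb{F}\odot\mathbb{G}$ is the $\top$-filter generated by the $\top$-filter base $\{\lambda\odot\mu:\lambda\in\mathbb{F},\mu\in\mathbb{G}\}$. *)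

(* Defs.v *)
From HB Require Import structures.
From mathcomp Require Import all_boot all_order all_classical.

Set Implicit Arguments.
Unset Strict Implicit.
Unset Printing Implicit Defensive.

Import Order.TTheory.
Local Open Scope classical_set_scope.
Local Open Scope order_scope.

HB.mixin Record hasSup (d : Order.disp_t) L of Order.TBLattice d L := {
  csup : set L -> L;
  csup_supremum : forall A : set L, supremums A (csup A)
}.

#[short(type="completeLatticeType")]
HB.structure Definition CompleteLattice (d : Order.disp_t) :=
  {L of Order.TBLattice d L & hasSup d L}.

(* The family (b_j) in the distributive law is given by its set of values. *)
HB.mixin Record isResiduated (d : Order.disp_t) L of CompleteLattice d L := {
  tens : L -> L -> L;
  tensA : associative tens;
  tensC : commutative tens;
  tensx1 : right_id \top tens;
  tens_csup : forall (a : L) (A : set L),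
    tens a (csup A) = csup [set tens a b | b in A]
}.

#[short(type="completeResiduatedType")]
HB.structure Definition CompleteResiduated (d : Order.disp_t) :=
  {L of CompleteLattice d L & isResiduated d L}.

Section Lattice.
Context {d : Order.disp_t} {L : completeResiduatedType d}.
Implicit Types (a b c : L) (A B : set L).

Definition cinf A : L := csup (lbound A).

Definition resid a b : L := csup [set c | tens a c <= b].

Lemma csup_ub A a : A a -> a <= csup A.
Proof. by move=> Aa; apply: (csup_supremum A).1. Qed.

Lemma csup_le A b : (forall a, A a -> a <= b) -> csup A <= b.
Proof. by move=> Ab; apply: (csup_supremum A).2. Qed.

Lemma csup_mono A B : A `<=` B -> csup A <= csup B.
Proof. by move=> AB; apply: csup_le => a /AB; exact: csup_ub. Qed.

Lemma csup_top A : A \top -> csup A = \top.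
Proof. by move=> At; apply/eqP; rewrite -le1x; exact: csup_ub. Qed.

Lemma cinf_lb A a : A a -> cinf A <= a.
Proof. by move=> Aa; apply: csup_le => b; apply. Qed.

Lemma cinf_ge A b : (forall a, A a -> b <= a) -> b <= cinf A.
Proof. by move=> bA; apply: csup_ub => a; exact: bA. Qed.

Lemma tens_mono2r a b c : b <= c -> tens a b <= tens a c.
Proof.
move=> bc; have cE : csup [set b; c] = c.
  apply/le_anti/andP; split; last by apply: csup_ub; right.
  by apply: csup_le => _ [->|->].
by rewrite -[X in _ <= tens a X]cE tens_csup; apply: csup_ub; exists b; [left|].
Qed.

Lemma tens_mono a a' b b' : a <= a' -> b <= b' -> tens a b <= tens a' b'.
Proof.
move=> aa bb; apply: le_trans (tens_mono2r a bb) _.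
by rewrite tensC [X in _ <= X]tensC tens_mono2r.
Qed.

Lemma tens_lel a b : tens a b <= a.
Proof. by rewrite -[X in _ <= X]tensx1 tens_mono2r // lex1. Qed.

Lemma tens_ler a b : tens a b <= b.
Proof. by rewrite tensC tens_lel. Qed.

Lemma tens_lemeet a b : tens a b <= (a `&` b)%O.
Proof. by rewrite lexI tens_lel tens_ler. Qed.

Lemma residP a b c : (tens a c <= b) <-> (c <= resid a b).
Proof.
split=> [h|h]; first exact: csup_ub.
apply: le_trans (tens_mono2r a h) _; rewrite tens_csup.
by apply: csup_le => _ [x /= hx <-].
Qed.

Lemma csup_tens A B b :
  csup A = \top -> csup B = \top ->
  (forall x y, A x -> B y -> tens x y <= b) -> b = \top.
Proof.
move=> At Bt h; apply/eqP; rewrite -le1x -[X in X <= _]tensx1 -[X in tens _ X]Bt.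
rewrite tens_csup; apply: csup_le => _ [y By <-].
rewrite -At tensC tens_csup; apply: csup_le => _ [x Ax <-].
by rewrite tensC; exact: h.
Qed.

End Lattice.

Section LSubsets.
Context {d : Order.disp_t} {L : completeResiduatedType d} {X : Type}.
Implicit Types l m n : X -> L.

Definition lmeet l m : X -> L := fun x => (l x `&` m x)%O.

Definition subsethood l m : L := cinf (range (fun x => resid (l x) (m x))).

Lemma le_subsethood a l m :
  (forall x, tens (l x) a <= m x) <-> (a <= subsethood l m).
Proof.
split=> [h|h x].
  by apply: cinf_ge => _ [x _ <-]; apply/residP; exact: h.
by apply/residP/(le_trans h)/cinf_lb; exists x.
Qed.

Lemma subsethood_top l m : (forall x, l x <= m x) -> subsethood l m = \top.
Proof.
move=> h; apply/eqP; rewrite -le1x; apply/le_subsethood => x.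
by rewrite tensx1.
Qed.

Lemma tens_subsethood l m x : tens (l x) (subsethood l m) <= m x.
Proof. exact: ((le_subsethood _ l m).2 (lexx _) x). Qed.

Lemma subsethood_trans l m n :
  tens (subsethood l m) (subsethood m n) <= subsethood l n.
Proof.
apply/le_subsethood => x; rewrite tensA.
exact: le_trans (tens_mono (tens_subsethood _ _ _) (lexx _)) (tens_subsethood _ _ _).
Qed.

Lemma subsethood_meet l l' m m' :
  tens (subsethood l m) (subsethood l' m') <=
  subsethood (lmeet l l') (lmeet m m').
Proof.
apply/le_subsethood => x; rewrite lexI; apply/andP; split.
  apply: le_trans (tens_subsethood l m x).
  by apply: tens_mono; [exact: leIl|exact: tens_lel].
apply: le_trans (tens_subsethood l' m' x).
by apply: tens_mono; [exact: leIr|exact: tens_ler].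
Qed.

End LSubsets.

Section TopFilters.
Context {d : Order.disp_t}.

Record is_top_filter (L : completeResiduatedType d) (X : Type)
    (F : set (X -> L)) : Prop := IsTopFilter {
  top_filter_nonempty : F !=set0;
  top_filter_csup : forall l, F l -> csup (range l) = \top;
  top_filter_meet : forall l m, F l -> F m -> F (lmeet l m);
  top_filter_closed : forall l,
    csup [set subsethood m l | m in F] = \top -> F l
}.

Record is_top_filter_base (L : completeResiduatedType d) (X : Type)
    (B : set (X -> L)) : Prop := IsTopFilterBase {
  top_base_nonempty : B !=set0;
  top_base_csup : forall l, B l -> csup (range l) = \top;
  top_base_meet : forall l m, B l -> B m ->
    csup [set subsethood n (lmeet l m) | n in B] = \top
}.

Record topFilter (L : completeResiduatedType d) (X : Type) := TopFilter {
  top_filter_set :> (X -> L) -> Prop;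
  top_filterP : is_top_filter top_filter_set
}.

Context {L : completeResiduatedType d}.

Section OneSet.
Context {X : Type}.
Implicit Types (F G : topFilter L X) (l m : X -> L).

Lemma top_filter_up F l m : F l -> (forall x, l x <= m x) -> F m.
Proof.
move=> Fl lm; apply: (top_filter_closed (top_filterP F)).
by apply: csup_top; exists l => //; exact: subsethood_top.
Qed.

Lemma generated_is_top_filter (B : set (X -> L)) : is_top_filter_base B ->
  is_top_filter [set l | csup [set subsethood m l | m in B] = \top].
Proof.
move=> [[b Bb] B1 B2]; split.
- by exists b; apply: csup_top; exists b => //; exact: subsethood_top.
- move=> l /= hl; apply/eqP; rewrite -le1x -[X in X <= _]hl.
  apply: csup_le => _ [m Bm <-].
  rewrite -[X in X <= _]tensx1 -(B1 _ Bm) tens_csup.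
  apply: csup_le => _ [_ [x _ <-] <-]; rewrite tensC.
  by apply: le_trans (tens_subsethood m l x) _; apply: csup_ub; exists x.
- move=> l m /= hl hm; apply: (csup_tens hl hm) => _ _ [l' Bl <-] [m' Bm <-].
  apply: le_trans (subsethood_meet _ _ _ _) _.
  rewrite -[X in X <= _]tensx1 -(B2 _ _ Bl Bm) tens_csup.
  apply: csup_le => _ [_ [n Bn <-] <-]; rewrite tensC.
  by apply: le_trans (subsethood_trans _ _ _) _; apply: csup_ub; exists n.
- move=> l /= hl; apply/eqP; rewrite -le1x -[X in X <= _]hl.
  apply: csup_le => _ [m hm <-].
  rewrite -[X in X <= _]tensx1 -hm tens_csup.
  apply: csup_le => _ [_ [n Bn <-] <-]; rewrite tensC.
  by apply: le_trans (subsethood_trans _ _ _) _; apply: csup_ub; exists n.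
Qed.

Definition generated_top_filter (B : set (X -> L)) (HB : is_top_filter_base B) :
  topFilter L X := TopFilter (generated_is_top_filter HB).

Lemma principal_is_top_filter (x : X) :
  is_top_filter [set l : X -> L | l x = \top].
Proof.
split.
- by exists (fun=> \top).
- by move=> l /= lx; apply: csup_top; exists x.
- by move=> l m /= lx mx; rewrite /lmeet lx mx meetxx.
- move=> l /= h; apply/eqP; rewrite -le1x -[X in X <= _]h.
  apply: csup_le => _ [m mx <-].
  by have := tens_subsethood m l x; rewrite mx tensC tensx1.
Qed.

(* The top-filter written [x]_T. *)
Definition principal_top_filter (x : X) : topFilter L X :=
  TopFilter (principal_is_top_filter x).

End OneSet.

Lemma image_is_top_filter (X Y : Type) (f : X -> Y) (F : topFilter L X) :
  is_top_filter [set m : Y -> L | F (m \o f)].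
Proof.
have [_ F1 F2 F3] := top_filterP F; split.
- exists (fun=> \top) => /=.
  have [l Fl] := top_filter_nonempty (top_filterP F).
  by apply: (top_filter_up Fl) => x; rewrite lex1.
- move=> m /= /F1 h; apply/eqP; rewrite -le1x -[X in X <= _]h.
  by apply: csup_mono => _ [x _ <-]; exists (f x).
- by move=> l m /= Fl Fm; exact: (F2 _ _ Fl Fm).
- move=> l /= h; apply: F3; apply/eqP; rewrite -le1x -[X in X <= _]h.
  apply: csup_le => _ [m Fm <-].
  apply: (@le_trans _ _ (subsethood (m \o f) (l \o f))).
    by apply/le_subsethood => x; exact: (tens_subsethood m l (f x)).
  by apply: csup_ub; exists (m \o f).
Qed.

Definition image_top_filter (X Y : Type) (f : X -> Y) (F : topFilter L X) :
  topFilter L Y := TopFilter (image_is_top_filter f F).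

End TopFilters.

Section Convergence.
Context {d : Order.disp_t}.

(* [conv C F x] reads "F converges to x". *)
Record topConvergence (L : completeResiduatedType d) (X : Type) :=
    TopConvergence {
  conv :> topFilter L X -> set X;
  conv_principal : forall x, conv (principal_top_filter x) x;
  conv_subset : forall (F G : topFilter L X) x,
    F `<=` G -> conv F x -> conv G x
}.

Context {L : completeResiduatedType d}.

Definition conv_continuous (X Y : Type) (CX : topConvergence L X)
    (CY : topConvergence L Y) (f : X -> Y) : Prop :=
  forall (F : topFilter L X) (x : X), CX F x -> CY (image_top_filter f F) (f x).

Section Product.
Context {X Y : Type} (CX : topConvergence L X) (CY : topConvergence L Y).

Definition prod_conv (F : topFilter L (X * Y)) : set (X * Y) :=
  [set p | CX (image_top_filter fst F) p.1 /\ CY (image_top_filter snd F) p.2].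

Lemma prod_conv_principal p : prod_conv (principal_top_filter p) p.
Proof.
by split; [apply: conv_subset (conv_principal CX p.1)
         | apply: conv_subset (conv_principal CY p.2)].
Qed.

Lemma prod_conv_subset (F G : topFilter L (X * Y)) p :
  F `<=` G -> prod_conv F p -> prod_conv G p.
Proof.
by move=> FG [F1 F2]; split;
   [apply: conv_subset F1 | apply: conv_subset F2] => m; exact: FG.
Qed.

Definition prod_convergence : topConvergence L (X * Y) :=
  TopConvergence prod_conv_principal prod_conv_subset.

End Product.
End Convergence.

Section Groups.
Context {d : Order.disp_t} {L : completeResiduatedType d} {X : groupType}.

Definition is_top_convergence_group (C : topConvergence L X) : Prop :=
  conv_continuous (prod_convergence C C) C (fun p : X * X => (p.1 * p.2)%g) /\
  conv_continuous C C (fun x : X => (x^-1)%g).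

Definition lodot (l m : X -> L) : X -> L := fun z =>
  csup [set (l p.1 `&` m p.2)%O | p in [set p : X * X | (p.1 * p.2)%g = z]].

Definition odot_base (F G : topFilter L X) : set (X -> L) :=
  [set lodot l m | l in F & m in G].

Lemma lodot_mono (l l' m m' : X -> L) :
  (forall x, l x <= l' x) -> (forall x, m x <= m' x) ->
  forall z, lodot l m z <= lodot l' m' z.
Proof.
move=> ll mm z; apply: csup_le => _ [p pz <-].
apply: (@le_trans _ _ (l' p.1 `&` m' p.2)%O); first exact: leI2.
by apply: csup_ub; exists p.
Qed.

Lemma odot_is_top_filter_base (F G : topFilter L X) :
  is_top_filter_base (odot_base F G).
Proof.
have [[l0 Fl0] F1 F2 _] := top_filterP F.
have [[m0 Gm0] G1 G2 _] := top_filterP G.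
split.
- by exists (lodot l0 m0), l0 => //; exists m0.
- move=> _ [l /F1 Fl [m /G1 Gm <-]].
  apply: (csup_tens Fl Gm) => _ _ [x _ <-] [y _ <-].
  apply: le_trans (tens_lemeet _ _) _.
  apply: (@le_trans _ _ (lodot l m (x * y)%g)); last by apply: csup_ub; exists (x * y)%g.
  by apply: csup_ub; exists (x, y).
- move=> _ _ [l Fl [m Gm <-]] [l' Fl' [m' Gm' <-]].
  apply: csup_top; exists (lodot (lmeet l l') (lmeet m m')).
    by exists (lmeet l l'); [exact: F2|exists (lmeet m m') => //; exact: G2].
  apply: subsethood_top => z; rewrite lexI; apply/andP; split.
    by apply: lodot_mono => x; exact: leIl.
  by apply: lodot_mono => x; exact: leIr.
Qed.

Definition odot (F G : topFilter L X) : topFilter L X :=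
  generated_top_filter (odot_is_top_filter_base F G).

End Groups.

(* Main.v *)
Require Import Defs.
From mathcomp Require Import all_boot all_order all_classical.

(** Multiplying a top-filter [F] by the point filter [[a]_T] merely translates
    it: as families of [L]-subsets, [[a]_T] odot [F] is the image of [F] under
    [y |-> a * y], and [F] odot [[a]_T] its image under [y |-> y * a]
    ([odot_principal_l], [odot_principal_r]).

    Translations are continuous for a top-convergence group, because
    [y |-> a * y] factors through [y |-> (a, y)] followed by the continuous
    multiplication ([mulg_continuous_l], [mulg_continuous_r]); the constant
    first coordinate converges to [a] since the image of any filter under a
    constant map contains the point filter.  The inverse of a translation is
    again a translation, so translations are homeomorphisms and both preserve
    and reflect convergence ([conv_image_iff]).  Translating by [x^-1] on either
    side takes [x] to the identity, so each of the two products converges to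
    the identity exactly when [F] converges to [x]. *)

Set Implicit Arguments.
Unset Strict Implicit.
Unset Printing Implicit Defensive.

Import Order.TTheory.
Local Open Scope classical_set_scope.
Local Open Scope order_scope.

Section GeneratedFilters.
Context {d : Order.disp_t} {L : completeResiduatedType d} {X : Type}.

Lemma generated_top_filter_le (B : set (X -> L)) (HB : is_top_filter_base B)
    (F : topFilter L X) :
  (forall l, B l -> F l) -> generated_top_filter HB `<=` F.
Proof.
move=> BF l /= hl; apply: (top_filter_closed (top_filterP F)).
apply/eqP; rewrite -le1x -[X in X <= _]hl.
by apply: csup_mono => _ [m Bm <-]; exists m => //; exact: BF.
Qed.

Lemma generated_top_filter_up (B : set (X -> L)) (HB : is_top_filter_base B)
    (b l : X -> L) :
  B b -> (forall x, b x <= l x) -> generated_top_filter HB l.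
Proof.
by move=> Bb bl; apply: csup_top; exists b => //; exact: subsethood_top.
Qed.

Lemma top_filter_const_top (F : topFilter L X) : F (fun=> \top).
Proof.
have [l Fl] := top_filter_nonempty (top_filterP F).
by apply: (top_filter_up Fl) => x; exact: lex1.
Qed.

(** The characteristic function of a point is the least member of the point
    filter, so estimates over that filter only need to be made on it. *)
Definition point_char (a : X) : X -> L :=
  fun x => if `[< x = a >] then \top else \bot.

Lemma point_char_self (a : X) : point_char a a = \top.
Proof. by rewrite /point_char asboolT. Qed.

Lemma point_char_other (a x : X) : x <> a -> point_char a x = \bot.
Proof. by move=> xa; rewrite /point_char asboolF. Qed.

End GeneratedFilters.

Section Homeomorphisms.
Context {d : Order.disp_t} {L : completeResiduatedType d} {X Y : Type}.

(** Every filter contains the constant function [\top], hence the pullback along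
    a constant map of any [m] with [m a = \top]; the point filter of [a] is
    therefore included in the image. *)
Lemma conv_image_const (C : topConvergence L Y) (a : Y) (F : topFilter L X) :
  C (image_top_filter (fun=> a) F) a.
Proof.
apply: conv_subset (conv_principal C a) => m /= ma.
by apply: (top_filter_up (top_filter_const_top F)) => x /=; rewrite ma.
Qed.

(** The image under [g] of the image of [F] under [f] is [F] again, so continuity
    of [g] reflects convergence back along [f]. *)
Lemma conv_image_iff (CX : topConvergence L X) (CY : topConvergence L Y)
    (f : X -> Y) (g : Y -> X) (F : topFilter L X) (x : X) :
  cancel f g -> conv_continuous CX CY f -> conv_continuous CY CX g ->
  CX F x <-> CY (image_top_filter f F) (f x).
Proof.
move=> fK cf cg; split=> [|/cg]; first exact: cf.
rewrite fK; apply: conv_subset => m /= Fm.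
by apply: (top_filter_up Fm) => y /=; rewrite fK.
Qed.

End Homeomorphisms.

Section Translations.
Context {d : Order.disp_t} {L : completeResiduatedType d} {X : groupType}.
Implicit Types (F : topFilter L X) (l m n : X -> L).

Lemma lodot_ge l m (x y : X) : (l x `&` m y)%O <= lodot l m (x * y)%g.
Proof. by apply: csup_ub; exists (x, y). Qed.

Lemma lodot_le l m n :
  (forall x y, (l x `&` m y)%O <= n (x * y)%g) -> forall z, lodot l m z <= n z.
Proof. by move=> h z; apply: csup_le => _ [[x y] /= <- <-]; exact: h. Qed.

(** A base element [l odot m] with [l a = \top] dominates the translate of [m]
    by [a]; conversely the product of the characteristic function of [a] with
    [n (a * _)] lies below [n]. *)
Lemma odot_principal_l (a : X) F l :
  odot (principal_top_filter a) F l <-> image_top_filter (fun y => a * y)%g F l.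
Proof.
split.
  apply: generated_top_filter_le => _ [m ma [n Fn <-]].
  apply: (top_filter_up Fn) => y.
  by apply: le_trans (lodot_ge m n a y); rewrite ma meet1x.
move=> Fl; apply: (@generated_top_filter_up _ _ _ _ _
  (lodot (point_char a) (l \o (fun y => a * y)%g))).
  exists (point_char a); first exact: point_char_self.
  by exists (l \o (fun y => a * y)%g).
apply: lodot_le => x y; have [->|xa] := pselect (x = a).
  exact: leIr.
by rewrite point_char_other // meet0x le0x.
Qed.

Lemma odot_principal_r (a : X) F l :
  odot F (principal_top_filter a) l <-> image_top_filter (fun y => y * a)%g F l.
Proof.
split.
  apply: generated_top_filter_le => _ [n Fn [m ma <-]].
  apply: (top_filter_up Fn) => y.
  by apply: le_trans (lodot_ge n m y a); rewrite ma meetx1.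
move=> Fl; apply: (@generated_top_filter_up _ _ _ _ _
  (lodot (l \o (fun y => y * a)%g) (point_char a))).
  exists (l \o (fun y => y * a)%g) => //.
  by exists (point_char a) => //; exact: point_char_self.
apply: lodot_le => y x; have [->|xa] := pselect (x = a).
  exact: leIl.
by rewrite point_char_other // meetx0 le0x.
Qed.

Context {C : topConvergence L X} (hC : is_top_convergence_group C).

(** The image of [F] under [y |-> (a, y)] has second projection [F], while its
    first projection is a constant image of [F], which converges to [a]. *)
Lemma mulg_continuous_l (a : X) : conv_continuous C C (fun y => a * y)%g.
Proof.
move=> F x Fx.
have /hC.1 : prod_convergence C C (image_top_filter (pair a) F) (a, x).
  split; last exact: conv_subset Fx.
  by apply: conv_subset (conv_image_const C a F).
exact: conv_subset.
Qed.

Lemma mulg_continuous_r (a : X) : conv_continuous C C (fun y => y * a)%g.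
Proof.
move=> F x Fx.
have /hC.1 : prod_convergence C C (image_top_filter (pair^~ a) F) (x, a).
  split; first exact: conv_subset Fx.
  by apply: conv_subset (conv_image_const C a F).
exact: conv_subset.
Qed.

Lemma conv_odot_principal_l F (a x : X) :
  C F x <-> C (odot (principal_top_filter a) F) (a * x)%g.
Proof.
rewrite (conv_image_iff (g := fun y => (a^-1 * y)%g) F x (mulKg a)
  (mulg_continuous_l a) (mulg_continuous_l _)).
by split; apply: conv_subset => l; rewrite odot_principal_l.
Qed.

Lemma conv_odot_principal_r F (a x : X) :
  C F x <-> C (odot F (principal_top_filter a)) (x * a)%g.
Proof.
rewrite (conv_image_iff (g := fun y => (y * a^-1)%g) F x (mulgK a)
  (mulg_continuous_r a) (mulg_continuous_r _)).
by split; apply: conv_subset => l; rewrite odot_principal_r.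
Qed.

End Translations.

Theorem theorem3p6 (d : Order.disp_t) (L : completeResiduatedType d)
    (X : groupType) (C : topConvergence L X) (hC : is_top_convergence_group C)
    (F : topFilter L X) (x : X) :
  (C F x <-> C (odot (principal_top_filter (x^-1)%g) F) 1%g) /\
  (C (odot (principal_top_filter (x^-1)%g) F) 1%g <->
   C (odot F (principal_top_filter (x^-1)%g)) 1%g).
Proof.
have := conv_odot_principal_l hC F (x^-1)%g x.
have := conv_odot_principal_r hC F (x^-1)%g x.
rewrite mulgV mulVg => Fr Fl; split; first exact: Fl.
by rewrite -Fl.
Qed.
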